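(* Let $n\ge 3$. The Mikado braids of type $D_n$, viewed inside $\widetilde{A}_{B_n}$, are precisely the images of those Mikado braids of type $B_n$ which surject onto elements of $W_{D_n}$, that is, $$\mathrm{Mik}(D_n)=\{\pi_{n,1}(\beta)\mid \beta\in\mathrm{Mik}(B_n)\ \text{and}\ \pi_n^B(\beta)\in W_{D_n}\}.$$
   Context: **Coxeter groups.** $W_{B_n}$ is the group of permutations $w$ of $\{-n,\dots,-1,1,\dots,n\}$ with $w(-i)=-w(i)$ for all $i$. It is a Coxeter group with simple system $S_{B_n}=\{s_0,\dots,s_{n-1}\}$, where $s_0=(-1,1)$ and $s_i=(i,i+1)(-i,-i-1)$ for $1\le i\le n-1$. Inside it, $W_{D_n}=\langle t_0,\dots,t_{n-1}\rangle$, where $t_0=s_0s_1s_0$ and $t_i=s_i$ for $1\le i\le n-1$, is an index two subgroup and a Coxeter group of type $D_n$ with simple system $S_{D_n}=\{t_0,\dots,t_{n-1}\}$. **Artin groups, canonical lifts, Mikado braids.** For a Coxeter system $(W,S)$, the Artin group $A_W$ is generated by a copy $\{\mathbf{s}\mid s\in S\}$ of $S$ subject only to the braid relations of $(W,S)$. For $w\in W$ with reduced expression $w=r_1\cdots r_k$ ($r_i\in S$), the canonical positive lift $\mathbf{w}=\mathbf{r}_1\cdots\mathbf{r}_k\in A_W$ is independent of the reduced expression. An element of $A_W$ is a Mikado braid if it equals $\mathbf{x}^{-1}\mathbf{y}$ for some $x,y\in W$. Write $A_{B_n},A_{D_n}$ for the Artin groups of $(W_{B_n},S_{B_n})$, $(W_{D_n},S_{D_n})$,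 and $\mathrm{Mik}(B_n)\subseteq A_{B_n}$, $\mathrm{Mik}(D_n)\subseteq A_{D_n}$ for their sets of Mikado braids. **The quotient $\widetilde{A}_{B_n}$.** $\widetilde{A}_{B_n}$ is the quotient of $A_{B_n}$ by the normal closure of $\mathbf{s}_0^2$, and $\pi_{n,1}:A_{B_n}\to\widetilde{A}_{B_n}$ is the quotient map. $\pi_n^B:A_{B_n}\to W_{B_n}$ is the canonical surjection $\mathbf{s}_i\mapsto s_i$. **Identification.** Let $s_i'=\pi_{n,1}(\mathbf{s}_i)$, $t_0'=s_0's_1's_0'$, $t_i'=s_i'$ for $1\le i\le n-1$. The assignment $\mathbf{t}_i\mapsto t_i'$ ($0\le i\le n-1$) defines an injective group homomorphism $\iota_n:A_{D_n}\to\widetilde{A}_{B_n}$ (this may be taken as known), and $A_{D_n}$ is identified with its image $\langle t_0',\dots,t_{n-1}'\rangle$; thus $\mathrm{Mik}(D_n)$ in the claim means $\iota_n(\mathrm{Mik}(D_n))$. *)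

(* Defs.v *)
From HB Require Import structures.
From mathcomp Require Import all_boot all_fingroup cyclic.
From mathcomp Require Import boolp classical_sets generic_quotient.

Set Implicit Arguments.
Unset Strict Implicit.
Unset Printing Implicit Defensive.

Local Open Scope quotient_scope.
Local Open Scope classical_set_scope.
Local Open Scope group_scope.

(* The letter (i, false) stands for i, and (i, true) for its inverse. *)
Section FreeGroup.
Variable I : choiceType.

Definition word := seq (I * bool).

Inductive word_eqv : word -> word -> Prop :=
| WordRefl u : word_eqv u u
| WordSym u v : word_eqv u v -> word_eqv v u
| WordTrans u v w : word_eqv u v -> word_eqv v w -> word_eqv u w
| WordCancel u i b v :
    word_eqv (u ++ [:: (i, b), (i, ~~ b) & v]) (u ++ v).

Definition word_eqvb (u v : word) : bool := `[< word_eqv u v >].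

Lemma word_eqvb_refl : reflexive word_eqvb.
Proof. by move=> u; apply/asboolP; apply: WordRefl. Qed.

Lemma word_eqvb_sym : symmetric word_eqvb.
Proof. by move=> u v; apply/idP/idP => /asboolP/WordSym/asboolP. Qed.

Lemma word_eqvb_trans : transitive word_eqvb.
Proof.
by move=> v u w /asboolP uv /asboolP vw; apply/asboolP; apply: WordTrans uv vw.
Qed.

Canonical word_eqv_rel :=
  EquivRel word_eqvb word_eqvb_refl word_eqvb_sym word_eqvb_trans.

Definition free_group : Type := {eq_quot word_eqvb}.
HB.instance Definition _ := Choice.on free_group.
HB.instance Definition _ := Quotient.on free_group.

Lemma free_groupP u v :
  \pi_free_group u = \pi_free_group v <-> word_eqv u v.
Proof.
split=> [/eqP|uv]; first by rewrite piE => /asboolP.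
by apply/eqP; rewrite piE; apply/asboolP.
Qed.

Lemma free_group_ind (P : free_group -> Prop) :
  (forall u, P (\pi_free_group u)) -> forall x, P x.
Proof. by move=> h x; rewrite -[x]reprK. Qed.

Lemma repr_word_eqv u : word_eqv (repr (\pi_free_group u)) u.
Proof. by apply/free_groupP; rewrite reprK. Qed.

Lemma word_eqv_catl w u v : word_eqv u v -> word_eqv (w ++ u) (w ++ v).
Proof.
elim=> {u v} [u|u v _|u v t _ uv _ vt|u i b v].
- exact: WordRefl.
- exact: WordSym.
- exact: WordTrans uv vt.
- by rewrite !catA; apply: WordCancel.
Qed.

Lemma word_eqv_catr w u v : word_eqv u v -> word_eqv (u ++ w) (v ++ w).
Proof.
elim=> {u v} [u|u v _|u v t _ uv _ vt|u i b v].
- exact: WordRefl.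
- exact: WordSym.
- exact: WordTrans uv vt.
- by rewrite -!catA /=; apply: WordCancel.
Qed.

Definition word_inv (u : word) : word := rev [seq (l.1, ~~ l.2) | l <- u].

Lemma word_inv_cat u v : word_inv (u ++ v) = word_inv v ++ word_inv u.
Proof. by rewrite /word_inv map_cat rev_cat. Qed.

Lemma word_invK : involutive word_inv.
Proof.
move=> u; rewrite /word_inv map_rev revK -map_comp map_id_in //.
by case=> i b _ /=; rewrite negbK.
Qed.

Lemma word_eqv_inv u v : word_eqv u v -> word_eqv (word_inv u) (word_inv v).
Proof.
elim=> {u v} [u|u v _|u v t _ uv _ vt|u i b v].
- exact: WordRefl.
- exact: WordSym.
- exact: WordTrans uv vt.
- rewrite -[_ :: _]/([:: (i, b); (i, ~~ b)] ++ v) !word_inv_cat -catA.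
  have -> : word_inv [:: (i, b); (i, ~~ b)] = [:: (i, b); (i, ~~ b)].
    by rewrite /word_inv /= negbK.
  exact: WordCancel.
Qed.

Lemma word_mulV u : word_eqv (u ++ word_inv u) [::].
Proof.
elim: u => [|[i b] u IHu]; first exact: WordRefl.
rewrite -cat1s word_inv_cat catA -(catA [:: (i, b)]).
apply: WordTrans (word_eqv_catr _ (word_eqv_catl [:: (i, b)] IHu)) _.
exact: (WordCancel [::] i b [::]).
Qed.

Definition free_mul (x y : free_group) : free_group := \pi_free_group (repr x ++ repr y).
Definition free_one : free_group := \pi_free_group [::].
Definition free_inv (x : free_group) : free_group := \pi_free_group (word_inv (repr x)).

Lemma free_mulE u v :
  free_mul (\pi_free_group u) (\pi_free_group v) = \pi_free_group (u ++ v).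
Proof.
apply/free_groupP; apply: WordTrans (word_eqv_catr _ (repr_word_eqv u)) _.
exact: word_eqv_catl (repr_word_eqv v).
Qed.

Lemma free_invE u : free_inv (\pi_free_group u) = \pi_free_group (word_inv u).
Proof. by apply/free_groupP; apply: word_eqv_inv (repr_word_eqv u). Qed.

Lemma free_mulA : associative free_mul.
Proof.
by elim/free_group_ind=> u; elim/free_group_ind=> v; elim/free_group_ind=> w; rewrite !free_mulE catA.
Qed.

Lemma free_mul1 : left_id free_one free_mul.
Proof. by elim/free_group_ind=> u; rewrite free_mulE. Qed.

Lemma free_mulr1 : right_id free_one free_mul.
Proof. by elim/free_group_ind=> u; rewrite free_mulE cats0. Qed.

Lemma free_mulrV : right_inverse free_one free_inv free_mul.
Proof.
by elim/free_group_ind=> u; rewrite free_invE free_mulE; apply/free_groupP/word_mulV.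
Qed.

Lemma free_mulV : left_inverse free_one free_inv free_mul.
Proof.
elim/free_group_ind=> u; rewrite free_invE free_mulE; apply/free_groupP.
by rewrite -{2}(word_invK u); apply: word_mulV.
Qed.

HB.instance Definition _ := isGroup.Build free_group
  free_mulA free_mul1 free_mulr1 free_mulV free_mulrV.

Definition free_gen (i : I) : free_group := \pi_free_group [:: (i, false)].

Section Lift.
Variables (H : groupType) (f : I -> H).

Definition word_eval (u : word) : H :=
  \prod_(l <- u) (if l.2 then (f l.1)^-1 else f l.1).

Lemma word_eval_eqv u v : word_eqv u v -> word_eval u = word_eval v.
Proof.
elim=> {u v} // [u v t _ -> _ -> //|u i b v].
rewrite /word_eval !big_cat !big_cons /=; congr (_ * _).
by case: b; rewrite ?mulKg ?mulVKg.
Qed.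

Definition free_lift (x : free_group) : H := word_eval (repr x).

Lemma free_liftE u : free_lift (\pi_free_group u) = word_eval u.
Proof. exact: word_eval_eqv (repr_word_eqv u). Qed.

Lemma free_lift_morph : monoid_morphism free_lift.
Proof.
split=> [|]; first by rewrite [LHS]free_liftE /word_eval big_nil.
elim/free_group_ind=> u; elim/free_group_ind=> v.
by rewrite [_ * _]free_mulE !free_liftE /word_eval big_cat.
Qed.

HB.instance Definition _ :=
  isUMagmaMorphism.Build free_group H free_lift free_lift_morph.

Lemma free_lift_gen i : free_lift (free_gen i) = f i.
Proof. by rewrite free_liftE /word_eval big_seq1. Qed.

End Lift.
End FreeGroup.

Section Quotient.
Variables (G : groupType) (R : set G).

Inductive normal_closure : G -> Prop :=
| NClosGen x : R x -> normal_closure x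
| NClos1 : normal_closure 1
| NClosM x y : normal_closure x -> normal_closure y -> normal_closure (x * y)
| NClosV x : normal_closure x -> normal_closure x^-1
| NClosJ x y : normal_closure x -> normal_closure (x ^ y).

Definition gquot_eqv (x y : G) : bool := `[< normal_closure (x^-1 * y) >].

Lemma gquot_eqv_refl : reflexive gquot_eqv.
Proof. by move=> x; apply/asboolP; rewrite mulVg; apply: NClos1. Qed.

Lemma gquot_eqv_sym : symmetric gquot_eqv.
Proof.
by move=> x y; apply/idP/idP=> /asboolP/NClosV; rewrite invgM invgK => /asboolP.
Qed.

Lemma gquot_eqv_trans : transitive gquot_eqv.
Proof.
move=> y x z /asboolP xy /asboolP yz; apply/asboolP.
by have := NClosM xy yz; rewrite -mulgA mulVKg.
Qed.

Canonical gquot_eqv_rel :=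
  EquivRel gquot_eqv gquot_eqv_refl gquot_eqv_sym gquot_eqv_trans.

Definition gquot : Type := {eq_quot gquot_eqv}.
HB.instance Definition _ := Choice.on gquot.
HB.instance Definition _ := Quotient.on gquot.

Definition gproj (x : G) : gquot := \pi_gquot x.

Lemma gprojP x y : gproj x = gproj y <-> normal_closure (x^-1 * y).
Proof.
split=> [/eqP|xy]; first by rewrite /gproj piE => /asboolP.
by apply/eqP; rewrite /gproj piE; apply/asboolP.
Qed.

Lemma gproj_repr x : gproj (repr x) = x.
Proof. exact: reprK. Qed.

Definition gquot_mul (x y : gquot) : gquot := gproj (repr x * repr y).
Definition gquot_inv (x : gquot) : gquot := gproj (repr x)^-1.

Lemma gquot_mulE x y : gquot_mul (gproj x) (gproj y) = gproj (x * y).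
Proof.
have /gprojP rx := gproj_repr (gproj x); have /gprojP ry := gproj_repr (gproj y).
apply/gprojP; have := NClosM ry (NClosJ y rx).
by rewrite /conjg invgM -!mulgA mulVKg.
Qed.

Lemma gquot_invE x : gquot_inv (gproj x) = gproj x^-1.
Proof.
have /gprojP rx := gproj_repr (gproj x).
apply/gprojP; have := NClosJ x^-1 (NClosV rx).
by rewrite /conjg !invgM !invgK !mulgA mulgV mul1g.
Qed.

Lemma gquot_ind (P : gquot -> Prop) : (forall x, P (gproj x)) -> forall x, P x.
Proof. by move=> h x; rewrite -[x]gproj_repr. Qed.

Lemma gquot_mulA : associative gquot_mul.
Proof.
elim/gquot_ind=> x; elim/gquot_ind=> y; elim/gquot_ind=> z.
by rewrite !gquot_mulE mulgA.
Qed.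

Lemma gquot_mul1 : left_id (gproj 1) gquot_mul.
Proof. by elim/gquot_ind=> x; rewrite gquot_mulE mul1g. Qed.

Lemma gquot_mulr1 : right_id (gproj 1) gquot_mul.
Proof. by elim/gquot_ind=> x; rewrite gquot_mulE mulg1. Qed.

Lemma gquot_mulV : left_inverse (gproj 1) gquot_inv gquot_mul.
Proof. by elim/gquot_ind=> x; rewrite gquot_invE gquot_mulE mulVg. Qed.

Lemma gquot_mulrV : right_inverse (gproj 1) gquot_inv gquot_mul.
Proof. by elim/gquot_ind=> x; rewrite gquot_invE gquot_mulE mulgV. Qed.

HB.instance Definition _ := isGroup.Build gquot
  gquot_mulA gquot_mul1 gquot_mulr1 gquot_mulV gquot_mulrV.

Lemma gproj_morph : monoid_morphism gproj.
Proof. by split=> // x y; rewrite [RHS]gquot_mulE. Qed.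

HB.instance Definition _ := isUMagmaMorphism.Build G gquot gproj gproj_morph.

Lemma gproj_rel x : R x -> gproj x = 1.
Proof.
by move=> Rx; apply/gprojP; rewrite mulg1; apply/NClosV/NClosGen.
Qed.

Section Lift.
Variables (H : groupType) (f : UMagmaMorphism.type G H).
Hypothesis fR : forall x, R x -> f x = 1.

Lemma normal_closure_ker x : normal_closure x -> f x = 1.
Proof.
elim=> {x} [x /fR //||x y _ fx _ fy|x _ fx|x y _ fx].
- exact: gmulf1.
- by rewrite gmulfM fx fy mulg1.
- by rewrite gmulfV fx invg1.
- by rewrite gmulfJ fx conj1g.
Qed.

Definition gquot_lift of (forall x, R x -> f x = 1) :=
  fun x : gquot => f (repr x).

Local Notation lift := (gquot_lift fR).

Lemma gquot_liftE x : lift (gproj x) = f x.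
Proof.
have /gprojP/normal_closure_ker := gproj_repr (gproj x).
by rewrite gmulfM gmulfV => e; apply: (mulgI (f (repr (gproj x)))^-1);
  rewrite e mulVg.
Qed.

Lemma gquot_lift_morph : monoid_morphism lift.
Proof.
split=> [|]; first by rewrite gquot_liftE gmulf1.
elim/gquot_ind=> x; elim/gquot_ind=> y.
by rewrite [_ * _]gquot_mulE !gquot_liftE gmulfM.
Qed.

End Lift.

HB.instance Definition _ (H : groupType) (f : UMagmaMorphism.type G H)
    (fR : forall x, R x -> f x = 1) :=
  isUMagmaMorphism.Build gquot H (gquot_lift fR) (gquot_lift_morph fR).

End Quotient.

Fixpoint altprod (G : groupType) (x y : G) (m : nat) : G :=
  if m is k.+1 then x * altprod y x k else 1.

Section Alternating.
Variable G : groupType.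
Implicit Types x y z : G.

Lemma gmulf_altprod (H : groupType) (f : UMagmaMorphism.type G H) x y m :
  f (altprod x y m) = altprod (f x) (f y) m.
Proof.
by elim: m x y => [|m IHm] x y /=; rewrite ?gmulf1 // gmulfM IHm.
Qed.

Lemma altprodJ x y z m : altprod (x ^ z) (y ^ z) m = altprod x y m ^ z.
Proof.
by elim: m x y => [|m IHm] x y /=; rewrite ?conj1g // conjMg IHm.
Qed.

Lemma altprod_invol x y m : x * x = 1 -> y * y = 1 ->
  altprod x y m * (altprod y x m)^-1 = (x * y) ^+ m.
Proof.
elim: m x y => [|m IHm] x y xx yy /=; first by rewrite expg0 mulgV.
have yV : y^-1 = y by rewrite -[y^-1]mulg1 -yy mulKg.
rewrite invgM yV !mulgA -(mulgA x) IHm //.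
have -> : y * x = (x * y) ^ x by rewrite /conjg -!mulgA mulKg.
by rewrite -conjXg /conjg mulVKg -mulgA expgSr.
Qed.

End Alternating.

(* S i, for i : I, are the simple reflections of a Coxeter system in a finite *)
(* group, so that the order #[S i * S j] is the finite Coxeter matrix entry   *)
(* for (i, j).                                                                *)
Section Artin.
Variables (I : choiceType) (gT : finGroupType) (S : I -> gT).

Definition braid_relators : set (free_group I) :=
  [set r | exists2 ij : I * I, ij.1 != ij.2 &
    r = altprod (free_gen ij.1) (free_gen ij.2) #[S ij.1 * S ij.2] *
        (altprod (free_gen ij.2) (free_gen ij.1) #[S ij.1 * S ij.2])^-1].

Definition artin : groupType := gquot braid_relators.
Definition artin_gen (i : I) : artin := gproj braid_relators (free_gen i).

Definition braided (G : groupType) (f : I -> G) : Prop :=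
  forall i j, i != j ->
  altprod (f i) (f j) #[S i * S j] = altprod (f j) (f i) #[S i * S j].

Lemma artin_gen_braided : braided artin_gen.
Proof.
move=> i j nij; apply/divg1_eq; rewrite -!gmulf_altprod -gmulfF.
by apply: gproj_rel; exists (i, j).
Qed.

Section Lift.
Variables (H : groupType) (f : I -> H) (fB : braided f).

Lemma free_lift_relators x : braid_relators x -> free_lift f x = 1.
Proof.
case=> [[i j] /= nij ->].
by rewrite gmulfF !gmulf_altprod /= !free_lift_gen fB // mulgV.
Qed.

Definition artin_lift : UMagmaMorphism.type artin H :=
  gquot_lift free_lift_relators.

Lemma artin_lift_gen i : artin_lift (artin_gen i) = f i.
Proof. by rewrite [LHS]gquot_liftE [LHS]free_lift_gen. Qed.

End Lift.

Lemma invol_braided : (forall i, S i * S i = 1) -> braided S.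
Proof.
by move=> S2 i j _; apply/divg1_eq; rewrite altprod_invol // expg_order.
Qed.

Definition reduced_expr (w : gT) (r : seq I) : Prop :=
  \prod_(i <- r) S i = w /\
  forall r', \prod_(i <- r') S i = w -> size r <= size r'.

(* By Matsumoto's theorem this set is a singleton when (W, S) is a Coxeter    *)
(* system and w is in W.                                                      *)
Definition canonical_lift (w : gT) : set artin :=
  [set b | exists2 r, reduced_expr w r & b = \prod_(i <- r) artin_gen i].

Definition mikado (W : {set gT}) : set artin :=
  [set b | exists x y bx by_, [/\ x \in W, y \in W,
     canonical_lift x bx, canonical_lift y by_ & b = bx^-1 * by_]].

End Artin.

Arguments artin_gen {I gT} S i.
Arguments canonical_lift {I gT} S w.
Arguments mikado {I gT} S W.

(* The pair (false, k) encodes the integer k + 1, and (true, k) encodes       *)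
(* - (k + 1).                                                                 *)
Definition signed n := (bool * 'I_n)%type.
Definition sopp n (x : signed n) : signed n := (~~ x.1, x.2).

Definition WB n : {set {perm signed n}} :=
  finset (fun w : {perm signed n} => [forall x, w (sopp x) == sopp (w x)]).

(* For i > 0, the integers i and i + 1 exchanged by s_i are encoded by the    *)
(* indices ord_pred i and i. Products in {perm _} compose from left to right; *)
(* as inversion exchanges this convention with the opposite one and fixes the *)
(* simple reflections, the choice affects neither the Artin groups nor the    *)
(* sets of Mikado braids, nor whether a braid projects into a subgroup of     *)
(* the group of signed permutations.                                          *)
Definition sB n (i : 'I_n) : {perm signed n} :=
  if i == 0 :> nat then tperm (true, i) (false, i)
  else tperm (false, ord_pred i) (false, i) * tperm (true, i) (true, ord_pred i).

(* This maps s_0, ..., s_(n-1) to s_0 s_1 s_0, s_1, ..., s_(n-1); for i = 0   *)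
(* and n > 1, the index ordS i is 1.                                          *)
Definition toD n (G : groupType) (s : 'I_n -> G) (i : 'I_n) : G :=
  if i == 0 :> nat then s i * s (ordS i) * s i else s i.

Definition tD n : 'I_n -> {perm signed n} := toD (G := {perm signed n}) (@sB n).

Definition WD n : {set {perm signed n}} := <<[set tD i | i in 'I_n]%SET>>.

Definition AB n : groupType := artin (@sB n).
Definition AD n : groupType := artin (@tD n).

Definition MikB n : set (AB n) := mikado (@sB n) (WB n).
Definition MikD n : set (AD n) := mikado (@tD n) (WD n).

Arguments MikB n : clear implicits.
Arguments MikD n : clear implicits.

Definition s0_square n : set (AB n) :=
  [set x | exists2 i : 'I_n, i = 0 :> nat & x = artin_gen (@sB n) i ^+ 2].

Definition AtB n : groupType := gquot (@s0_square n).

Definition pi1 n : UMagmaMorphism.type (AB n) (AtB n) := gproj (@s0_square n).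

Definition s' n (i : 'I_n) : AtB n := pi1 n (artin_gen (@sB n) i).
Definition t' n : 'I_n -> AtB n := toD (@s' n).

Section TypeB.
Variable n : nat.
Implicit Types (i j : 'I_n) (x : signed n).

Lemma val_ord_pred i : i != 0 :> nat -> ord_pred i = i.-1 :> nat.
Proof.
case: n i => [[//]|k] i i0 /=; have i_lt := ltn_ord i.
rewrite -subn1 -addnBAC ?lt0n // modnDr modn_small ?subn1 //.
exact: leq_ltn_trans (leq_pred _) i_lt.
Qed.

Lemma val_ordS0 i : i = 0 :> nat -> (1 < n)%N -> ordS i = 1%N :> nat.
Proof. by move=> /= -> n1; rewrite modn_small. Qed.

Lemma sBE i x : sB i x =
  if i == 0 :> nat then (if x.2 == i then ~~ x.1 else x.1, x.2)
  else (x.1, if x.2 == i then ord_pred i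
             else if x.2 == ord_pred i then i else x.2).
Proof.
case: x => b k; rewrite /sB; case: eqP => [_|/eqP i0] /=.
  rewrite permE /= !xpair_eqE.
  by case: (k =P i) => [->|]; case: b.
have ni : i != ord_pred i.
  apply/eqP => e; have := val_ord_pred i0; rewrite -e.
  by case: (i : nat) i0 => // m _ /eqP; rewrite gtn_eqF.
have [nf nf'] : i != ord_pred i /\ ord_pred i != i by split; rewrite // eq_sym.
rewrite permM; case: (eqVneq k i) => [->|nk].
  case: b; last by rewrite tpermR tpermD.
  by rewrite [tperm (false, _) _ _]tpermD // tpermL.
case: (eqVneq k (ord_pred i)) => [->|nk'].
  case: b; first by rewrite [tperm (false, _) _ _]tpermD // tpermR.
  by rewrite tpermL tpermD // xpair_eqE.
by case: b; rewrite !tpermD ?xpair_eqE //= eq_sym.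
Qed.

Lemma neq_ord_pred i : i != 0 :> nat -> (i == ord_pred i) = false.
Proof.
move=> i0; apply/eqP => e; have := val_ord_pred i0; rewrite -e.
by case: (i : nat) i0 => // m _ /eqP; rewrite gtn_eqF.
Qed.

Lemma sB_invol i : sB i * sB i = 1.
Proof.
apply/permP => -[b k]; rewrite permM perm1 !sBE /=; case: eqP => [_|/eqP i0] /=.
  by case: eqP => //=; rewrite negbK.
have [->|nk] := eqVneq k i; first by rewrite eq_sym neq_ord_pred // eqxx.
by have [->|nk'] := eqVneq k (ord_pred i); rewrite ?eqxx ?(negPf nk) ?(negPf nk').
Qed.

Lemma sB_comm0 i j : i = 0 :> nat -> (1 < j)%N -> sB i * sB j = sB j * sB i.
Proof.
move=> i0 j1; have j0 : j != 0 :> nat by case: (j : nat) j1.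
have pj : ord_pred j = j.-1 :> nat by rewrite val_ord_pred.
have nij : (j == i) = false by apply/eqP => e; rewrite e i0 in j1.
have npi : (ord_pred j == i) = false.
  by apply/eqP => e; move: pj; rewrite e i0; case: (j : nat) j1 => [|[]].
apply/permP => -[b k]; rewrite !permM !sBE i0 (negPf j0) /=.
have [->|nk] := eqVneq k j; first by rewrite npi nij ?eqxx.
have [->|nk'] := eqVneq k (ord_pred j).
  by rewrite npi nij ?eqxx ?(eq_sym _ j) ?neq_ord_pred.
by rewrite ?(negPf nk) ?(negPf nk').
Qed.

Lemma order_sB0 i j : i = 0 :> nat -> (1 < j)%N -> #[sB i * sB j] = 2.
Proof.
move=> i0 j1; apply: nt_prime_order => //.
  by rewrite expgS expg1 {2}sB_comm0 // mulgA -(mulgA (sB i)) sB_invol mulg1 sB_invol.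
apply/eqP => /permP/(_ (true, i)); rewrite permM perm1 !sBE i0 /= eqxx.
by case: eqP j1 => [->|].
Qed.

Lemma order_sB01 i : i = 0 :> nat -> (1 < n)%N -> #[sB i * sB (ordS i)] = 4.
Proof.
move=> i0 n1; have j1 := val_ordS0 i0 n1; set j := ordS i in j1 *.
have j0 : j != 0 :> nat by rewrite j1.
have pj : ord_pred j = i by rewrite /j ordSK.
have nij : (j == i) = false by apply/eqP => e; rewrite e i0 in j1.
have nji : (i == j) = false by rewrite eq_sym.
have sqE x : ((sB i * sB j) ^+ 2) x =
    (if (x.2 == i) || (x.2 == j) then ~~ x.1 else x.1, x.2).
  case: x => b k; rewrite expgS expg1 !permM !sBE i0 (negPf j0) /= pj.
  have [->|nk] := eqVneq k i; first by rewrite ?(nij, nji, eqxx).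
  have [->|nk'] := eqVneq k j; first by rewrite ?(nij, nji, eqxx).
  by rewrite ?(negPf nk) ?(negPf nk').
have sq_neq1 : (sB i * sB j) ^+ 2 != 1.
  by apply/eqP => /permP/(_ (true, i)); rewrite sqE perm1 /= eqxx.
have n4 : (sB i * sB j) ^+ 4 = 1.
  rewrite (expgM _ 2 2); apply/permP => x.
  rewrite expgS expg1 permM perm1 !sqE /=.
  by case: x => b k /=; case: (_ || _); rewrite ?negbK.
have : #[sB i * sB j] %| 4 by rewrite order_dvdn n4.
have : ~~ (#[sB i * sB j] %| 2) by rewrite order_dvdn.
by move: #[_] => m; do 5![case: m => [//|m]] => _ /dvdn_leq -/(_ isT).
Qed.

Lemma tD_invol i : tD i * tD i = 1.
Proof.
rewrite /tD /toD; case: ifP => _; last exact: sB_invol.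
rewrite -!mulgA (mulgA (sB i) (sB i)) sB_invol mul1g.
by rewrite (mulgA (sB (ordS i))) sB_invol mul1g sB_invol.
Qed.

Lemma order_tD0 i : i = 0 :> nat -> (1 < n)%N -> #[tD i * tD (ordS i)] = 2.
Proof.
move=> i0 n1; rewrite /tD /toD i0 val_ordS0 //=.
rewrite -[_ * _ * _ * _]/(sB i * sB (ordS i) * sB i * sB (ordS i)).
rewrite -(mulgA (_ * _)) -[X in #[X]]/((sB i * sB (ordS i)) ^+ 2).
by rewrite orderXdiv order_sB01.
Qed.

Lemma order_tD0j i j : i = 0 :> nat -> (1 < j)%N ->
  #[tD i * tD j] = #[sB (ordS i) * sB j].
Proof.
move=> i0 j1; have j0 : (j == 0 :> nat) = false by case: (j : nat) j1.
have iV : (sB i)^-1 = sB i by rewrite -[LHS]mulg1 -(sB_invol i) mulKg.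
rewrite /tD /toD i0 j0 /=; set s1 := sB (ordS i).
rewrite -[RHS](orderJ _ (sB i)); congr #[_].
by rewrite /conjg iV -!mulgA -(sB_comm0 i0 j1).
Qed.

Lemma order_mulC (x y : {perm signed n}) : #[x * y] = #[y * x].
Proof. by rewrite -(orderJ (x * y) x) /conjg -mulgA mulKg. Qed.

Lemma s'_braided : braided (@sB n) (@s' n).
Proof.
move=> i j nij; have := congr1 (pi1 n) (artin_gen_braided (@sB n) nij).
by rewrite !gmulf_altprod.
Qed.

Lemma s'_invol i : i = 0 :> nat -> s' i * s' i = 1.
Proof.
move=> i0; rewrite -gmulfM; apply: gproj_rel.
by exists i; rewrite // expgS expg1.
Qed.

Lemma t'_braided0 i j : i = 0 :> nat -> i != j ->
  altprod (t' i) (t' j) #[tD i * tD j] = altprod (t' j) (t' i) #[tD i * tD j].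
Proof.
move=> i0 nij; have n0 : (j != 0 :> nat).
  by apply: contra nij => /eqP e; apply/eqP/val_inj; rewrite /= i0 e.
have n1 : (1 < n)%N by apply: leq_ltn_trans (ltn_ord j); rewrite lt0n.
have iV : (s' i)^-1 = s' i by rewrite -[LHS]mulg1 -(s'_invol i0) mulKg.
have [j1|] := leqP j 1.
  have -> : j = ordS i.
    apply: val_inj; rewrite [RHS]val_ordS0 //=; apply/eqP.
    by rewrite eqn_leq j1 lt0n.
  rewrite order_tD0 // /t' /toD i0 val_ordS0 //=.
  have nS : i != ordS i by apply/eqP => /(congr1 val)/=; rewrite -/(val (ordS i)) [X in _ = X]val_ordS0 // i0.
  have /= := s'_braided nS; rewrite order_sB01 //= !mulg1 !mulgA => e.
  by rewrite e.
move=> j1; rewrite order_tD0j //.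
have c : s' i * s' j = s' j * s' i.
  by have := s'_braided nij; rewrite order_sB0 //= !mulg1.
have -> : t' i = s' (ordS i) ^ s' i by rewrite /t' /toD i0 /conjg iV mulgA.
have -> : t' j = s' j ^ s' i by rewrite /t' /toD (negPf n0) conjgE -c mulKg.
rewrite !altprodJ s'_braided //.
by apply/eqP => e; move: j1; rewrite -e val_ordS0.
Qed.

Lemma t'_braided : braided (@tD n) (@t' n).
Proof.
move=> i j nij; have [i0|i0] := eqVneq (i : nat) 0; first exact: t'_braided0.
have [j0|j0] := eqVneq (j : nat) 0.
  by rewrite order_mulC t'_braided0 // eq_sym.
by rewrite /t' /tD /toD (negPf i0) (negPf j0); apply: s'_braided.
Qed.

End TypeB.

Definition piB n : UMagmaMorphism.type (AB n) {perm signed n} :=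
  artin_lift (invol_braided (@sB_invol n)).

Lemma piB_gen n i : piB n (artin_gen (@sB n) i) = sB i.
Proof. exact: artin_lift_gen. Qed.

Definition iotaAD n : UMagmaMorphism.type (AD n) (AtB n) :=
  artin_lift (@t'_braided n).

Lemma iotaAD_gen n i : iotaAD n (artin_gen (@tD n) i) = t' i.
Proof. exact: artin_lift_gen. Qed.

Lemma WB_group_set n : group_set (WB n).
Proof.
apply/group_setP; split=> [|u v].
  by rewrite inE; apply/forallP => x; rewrite !perm1.
rewrite !inE => /forallP uP /forallP vP; apply/forallP => x.
by rewrite !permM (eqP (uP x)) (eqP (vP _)).
Qed.

Canonical WB_group n := Group (WB_group_set n).

Lemma sB_WB n i : sB i \in WB n.
Proof.
rewrite inE; apply/forallP => -[b k]; rewrite !sBE /sopp /=.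
by case: ifP => // _; case: ifP.
Qed.

Lemma piB_WB n b : piB n b \in WB n.
Proof.
elim/gquot_ind: b; elim/free_group_ind => u.
rewrite [X in X \in _]gquot_liftE [X in X \in _]free_liftE.
apply: group_prod => -[i c] _ /=.
by case: c; rewrite ?groupV sB_WB.
Qed.

(* Main.v *)
(* In the quotient, s_0 is an involution that normalises A_D and exchanges t_0
   and t_1. Moving every s_0 to the left therefore turns a B-word for w into
   s_0^e times a D-word. If the B-word is reduced, so is the D-word: otherwise
   the deletion condition of type D removes two letters from the latter, hence
   also from the former. By Matsumoto's theorem for type D, the image of the
   canonical lift of w is then s_0^e times a canonical lift of s_0^e w in W_D,
   with e the parity of w as a permutation; in x^-1 y the two factors s_0^e
   cancel exactly because x^-1 y lies in W_D, which consists of even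
   permutations. *)
Require Import Defs.
From mathcomp Require Import all_boot all_fingroup cyclic alt zify.
From mathcomp Require Import boolp classical_sets.

Set Implicit Arguments.
Unset Strict Implicit.

Local Open Scope classical_set_scope.
Local Open Scope group_scope.

(** * Exchange, deletion and Matsumoto's theorem for words in involutions *)

Section Words.
Variables (I : choiceType) (gT : finGroupType) (S : I -> gT).
Implicit Types (i j : I) (r : seq I).

Definition reduced r :=
  forall r', \prod_(i <- r') S i = \prod_(i <- r) S i -> size r <= size r'.

Definition exchangeable i r := exists r1 k r2,
  r = r1 ++ k :: r2 /\ S i * \prod_(j <- r) S j = \prod_(j <- r1 ++ r2) S j.

Lemma reduced_exists r :
  exists2 r', reduced r' & \prod_(i <- r') S i = \prod_(i <- r) S i.
Proof.
have [m] := ubnP (size r); elim: m r => // m IHm r r_lt.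
have [r_red|/existsNP[r' /not_implyP[e /negP]]] := pselect (reduced r).
  by exists r.
rewrite -ltnNge => r'_lt; have [|u u_red ue] := IHm r'.
  exact: leq_trans r'_lt _.
by exists u; rewrite ?ue.
Qed.

Lemma reduced_catl r1 r2 : reduced (r1 ++ r2) -> reduced r1.
Proof.
move=> red r e; have := red (r ++ r2).
by rewrite !big_cat /= e !size_cat leq_add2r; apply.
Qed.

Lemma reduced_catr r1 r2 : reduced (r1 ++ r2) -> reduced r2.
Proof.
move=> red r e; have := red (r1 ++ r).
by rewrite !big_cat /= e !size_cat leq_add2l; apply.
Qed.

Fixpoint altword i j m : seq I := if m is k.+1 then i :: altword j i k else [::].

Lemma size_altword i j m : size (altword i j m) = m.
Proof. by elim: m i j => //= m IHm i j; rewrite IHm. Qed.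

Lemma take_altword i j m k : k <= m -> take k (altword i j m) = altword i j k.
Proof. by elim: m k i j => [|m IHm] [|k] i j //= km; rewrite IHm. Qed.

Lemma prod_altword (G : groupType) (f : I -> G) i j m :
  \prod_(k <- altword i j m) f k = altprod (f i) (f j) m.
Proof. by elim: m i j => [|m IHm] i j; rewrite ?big_nil //= big_cons IHm. Qed.

Hypothesis S2 : forall i, S i * S i = 1.
(** This takes the place of a length function and of root systems: in a Coxeter group, one of w and
    [S i * w] makes the simple root of [i] negative, and every word for that element, reduced or
    not, admits an exchange. *)
Hypothesis descent : forall i w,
  (forall r, \prod_(j <- r) S j = w -> exchangeable i r) \/
  (forall r, \prod_(j <- r) S j = S i * w -> exchangeable i r).

(** In the second case of [descent], a word for [S i * w] no longer than [r] would lose a letter on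
    multiplication by [S i], giving a word for w shorter than [r]. *)
Lemma exchange i r : reduced r -> ~ reduced (i :: r) -> exchangeable i r.
Proof.
move=> red /existsNP[u /not_implyP[ue /negP]]; rewrite -ltnNge /= ltnS => u_le.
have [|nexch] := descent i (\prod_(j <- r) S j); first exact.
rewrite big_cons in ue; have [r1 [k [r2 [e]]]] := nexch u ue.
rewrite ue mulgA S2 mul1g => /esym/red.
by rewrite leqNgt (leq_trans _ u_le) // e !size_cat /= addnS.
Qed.

Lemma deletion r : ~ reduced r -> exists r1 i r2 j r3,
  r = r1 ++ i :: r2 ++ j :: r3 /\
  \prod_(k <- r) S k = \prod_(k <- r1 ++ r2 ++ r3) S k.
Proof.
elim: r => [|i r IHr] nred; first by case: nred.
have [/exchange/(_ nred)[r1 [j [r2 [-> e]]]]|/IHr] := pselect (reduced r).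
  by exists [::], i, r1, j, r2; split=> //; rewrite big_cons e.
move=> [r1 [j [r2 [k [r3 [-> e]]]]]]; exists (i :: r1), j, r2, k, r3.
by split=> //; rewrite cat_cons !big_cons e.
Qed.

(** Equality of the two products says that [(S i * S j) ^+ k] is 1, so the order m is at most [k].
    If m were smaller, the m letters after the initial [i] could be replaced by the alternating word
    starting with [i], and the two adjacent [i] would cancel. *)
Lemma altword_reduced_order i j k : 0 < k -> i != j -> reduced (altword i j k) ->
  \prod_(l <- altword i j k) S l = \prod_(l <- altword j i k) S l ->
  k = #[S i * S j].
Proof.
move=> k0 nij red; rewrite !prod_altword => e; apply/eqP; rewrite eqn_leq.
have /dvdn_leq-> // : #[S i * S j] %| k.
  by rewrite order_dvdn -altprod_invol // e mulgV.
rewrite andbT leqNgt; apply/negP => lt_k.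
have m0 := order_gt0 (S i * S j); set m := #[_] in lt_k m0 *.
case: k k0 red e lt_k => // k _ red _ lt_k.
have := cat_take_drop m (altword j i k); rewrite take_altword // => e.
have := red (behead (altword i j m) ++ drop m (altword j i k)).
rewrite /= -{3}e !size_cat /= size_behead !size_altword => red'.
suff /red' : \prod_(l <- behead (altword i j m) ++ drop m (altword j i k)) S l
  = \prod_(l <- i :: altword j i k) S l.
  by rewrite ltnNge leq_add2r leq_pred.
rewrite big_cons -[in RHS]e !big_cat /= [in RHS]prod_altword mulgA; congr (_ * _).
rewrite -(invol_braided S2 nij) -/m.
by case: (m) m0 => //= l _; rewrite mulgA S2 mul1g prod_altword.
Qed.

Section Matsumoto.
Variables (G : groupType) (f : I -> G) (fB : braided S f).

(** Induction on the length. Reduced words with a common first or last letter are settled by the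
    induction hypothesis; any other counterexample is driven towards two alternating words, which a
    braid relation identifies. *)
Lemma matsumoto r r' : reduced r -> reduced r' ->
  \prod_(i <- r) S i = \prod_(i <- r') S i ->
  \prod_(i <- r) f i = \prod_(i <- r') f i.
Proof.
move: {2}(size r) (erefl (size r)) => k; elim: k r r' => [|k IHk] r r' rk red red' e.
  have := red' _ e; rewrite rk leqn0 => /nilP->.
  by move/size0nil: rk => ->.
have r'k : size r' = k.+1 by apply/eqP; rewrite -rk eqn_leq red // red'.
have head i u v : size u = k -> reduced (i :: u) -> reduced (i :: v) ->
    \prod_(l <- i :: u) S l = \prod_(l <- i :: v) S l ->
    \prod_(l <- i :: u) f l = \prod_(l <- i :: v) f l.
  move=> uk /(@reduced_catr [:: i]) ur /(@reduced_catr [:: i]) vr.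
  by rewrite !big_cons => /mulgI/(IHk _ _ uk ur vr)->.
apply: contrapT => nf.
pose bad i j u v := [/\ [/\ size u = k.+1, reduced u & reduced v],
  \prod_(l <- u) S l = \prod_(l <- v) S l,
  \prod_(l <- u) f l <> \prod_(l <- v) f l,
  ohead u = Some i & ohead v = Some j].
have badneq i j u v : bad i j u v -> i != j.
  case=> -[]; case: u v => [|i' u] // [|j' v] // [uk] ur vr es ef [ei] [ej].
  by apply/eqP => eij; subst; apply: ef; apply: head.
(* By exchange, [j u] loses a letter of [u]; it must be the last one, as
   otherwise the two words share their last letter. *)
have step i j u v : bad i j u v -> bad j i (j :: take k u) u.
  move=> /[dup] /badneq nij [[uk ur vr] es ef eu ev].
  have vk : size v = k.+1.
    by apply/eqP; rewrite eqn_leq -uk ur ?vr.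
  case: v => // j' v in vr es ef ev vk *; case: ev => ej; subst j'.
  have [|u1 [x [u2 [eu' es']]]] := @exchange j u ur.
    move=> /(_ v); rewrite big_cons es big_cons mulgA S2 mul1g => /(_ erefl).
    by rewrite /= uk; case: vk => ->; rewrite ltnNge leqnSn.
  have eu12 : \prod_(l <- j :: u1 ++ u2) S l = \prod_(l <- u) S l.
    by rewrite big_cons -es' mulgA S2 mul1g.
  have sz : size (u1 ++ u2) = k.
    by move: uk; rewrite eu' !size_cat /= addnS => -[].
  have red12 : reduced (j :: u1 ++ u2).
    by move=> u'; rewrite eu12 /= sz -uk; apply: ur.
  have ef12 : \prod_(l <- j :: u1 ++ u2) f l = \prod_(l <- j :: v) f l.
    by apply: head; rewrite ?eu12.
  case/lastP: u2 => [|u2 y] in eu' sz red12 ef12 eu12 es' *.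
    rewrite cats0 in sz red12 ef12 eu12.
    have -> : take k u = u1 by rewrite eu' take_size_cat.
    by split=> //; [split=> //=; rewrite sz|rewrite ef12 => e'; apply: ef].
  case: ef; rewrite -ef12.
  have ea : u = (u1 ++ x :: u2) ++ [:: y] by rewrite eu' cats1 rcons_cat.
  have eb : j :: u1 ++ rcons u2 y = (j :: u1 ++ u2) ++ [:: y].
    by rewrite cats1 rcons_cons rcons_cat.
  rewrite eb ea in eu12 red12 ur uk *.
  rewrite !(@big_cat _ _ _ _ _ [:: y]) /= in eu12 *; congr (_ * _).
  apply: IHk (reduced_catl ur) (reduced_catl red12) _.
    by move: uk; rewrite size_cat addn1 => -[].
  by move/mulIg: eu12.
(* Iterating the step forces a counterexample with an alternating word. *)
have chain m : m < k.+1 -> exists i j u v, bad i j u v /\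
    take m.+1 u = altword i j m.+1.
  elim: m => [|m IHm] mk.
    case: r r' => [|i r] // [|j r'] // in rk r'k red red' e nf *.
    by exists i, j, (i :: r), (j :: r'); split=> //; rewrite /= take0.
  have [i [j [u [v [/step buv eu]]]]] := IHm (ltnW mk).
  exists j, i, (j :: take k u), u; split=> //=.
  by rewrite take_takel // eu.
have [i [j [u [v [buv eu]]]]] := chain k (ltnSn k).
have uE : u = altword i j k.+1.
  by case: buv => -[uk _ _] _ _ _ _; rewrite -eu -uk take_size.
have nij := badneq _ _ _ _ buv.
(* One more step makes both words of the pair alternating; their length must then be the order of
   [S i * S j]. *)
have [[_ _ ured] es ef _ _] := step _ _ _ _ buv.
have vE : j :: take k u = altword j i k.+1 by rewrite uE take_altword.
rewrite vE uE in es ef ured *.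
apply: ef; rewrite !prod_altword.
by rewrite (@altword_reduced_order i j k.+1) // fB.
Qed.

End Matsumoto.
End Words.

(** * The exchange condition in type D *)

Section TypeD.
Variable n : nat.
Hypothesis n1 : 1 < n.
Implicit Types (i j k : 'I_n) (x y : signed n).

(** The position of [x], counted from 0, in the order -n < ... < -1 < 1 < ... < n. Inversions become
    inequalities between natural numbers. *)
Definition srank x : nat := if x.1 then n - x.2.+1 else n + x.2.

Lemma srank_inj : injective srank.
Proof.
by case=> [[] [k kn]] [[] [l ln]]; rewrite /srank /= => e; (try lia);
  congr (_, _); apply: val_inj => /=; lia.
Qed.

(* The reflection exchanging the roots [e_x - e_y] and [e_y - e_x]. *)
Definition stperm x y : {perm signed n} := tperm x y * tperm (sopp x) (sopp y).

Lemma stpermJ x y (w : {perm signed n}) : w \in WB n ->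
  stperm x y ^ w = stperm (w x) (w y).
Proof.
rewrite inE => /forallP wP; rewrite /stperm conjMg !tpermJ.
by rewrite !(eqP (wP _)).
Qed.

Lemma ordS0_neq i : i = 0 :> nat -> ((ordS i == i) = false) * ((i == ordS i) = false).
Proof.
move=> i0; have e : (ordS i == i) = false.
  by apply/eqP => /(congr1 val); rewrite [X in X = _](val_ordS0 i0 n1) /= i0.
by split; last rewrite eq_sym.
Qed.

Lemma tD0E i x : i = 0 :> nat -> tD i x =
  if x.2 == i then (~~ x.1, ordS i)
  else if x.2 == ordS i then (~~ x.1, i) else x.
Proof.
move=> i0; have j1 := val_ordS0 i0 n1; have nij := ordS0_neq i0.
case: x => b k; rewrite /tD /toD i0 /= !permM !sBE i0 j1 ordSK /=.
have [->|nk] := eqVneq k i; first by rewrite ?(nij, eqxx).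
by have [_|] := eqVneq k (ordS i); rewrite ?eqxx ?(negPf nk).
Qed.

Lemma tD0_stperm i : i = 0 :> nat -> tD i = stperm (true, i) (false, ordS i).
Proof.
move=> i0; have iV : (sB i)^-1 = sB i by rewrite -[LHS]mulg1 -(sB_invol i) mulKg.
have -> : tD i = sB (ordS i) ^ sB i by rewrite /tD /toD i0 /= /conjg iV mulgA.
have -> : sB (ordS i) = stperm (false, i) (false, ordS i).
  by rewrite /sB (val_ordS0 i0 n1) /= ordSK /stperm (tpermC (true, ordS i)).
by rewrite stpermJ ?sB_WB // !sBE i0 /= eqxx ordS0_neq.
Qed.

Lemma tDS_stperm i : i != 0 :> nat -> tD i = stperm (false, ord_pred i) (false, i).
Proof.
by move=> i0; rewrite /tD /toD /sB (negPf i0) /stperm (tpermC (true, i)).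
Qed.

Lemma tD_simple i : exists x y,
  [/\ srank x < srank y, y != sopp x, tD i = stperm x y & tD i x = y /\ tD i y = x].
Proof.
have [i0|i0] := eqVneq (i : nat) 0.
  have j1 := val_ordS0 i0 n1; exists (true, i), (false, ordS i); split.
  - by rewrite /srank /= i0; lia.
  - by rewrite /sopp xpair_eqE ordS0_neq.
  - exact: tD0_stperm.
  - by rewrite !tD0E //= !eqxx ordS0_neq.
have pi := val_ord_pred i0; exists (false, ord_pred i), (false, i); split.
- by rewrite /srank pi /=; move: i0; lia.
- by [].
- exact: tDS_stperm.
- by rewrite /tD /toD (negPf i0) !sBE (negPf i0) /= !eqxx eq_sym neq_ord_pred.
Qed.

(** Since [y] is not opposite to [x], the two transpositions have disjoint supports and commute. *)
Lemma stpermC x y : y != sopp x -> x != y -> stperm (sopp y) (sopp x) = stperm x y.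
Proof.
case: x y => [b k] [c l]; rewrite /stperm /sopp /= !negbK => nyx nxy.
rewrite (tpermC (c, l)) (tpermC (~~ c, l)) -[LHS](mulVKg (tperm (b, k) (c, l))).
rewrite tpermV; congr (_ * _).
have -> : tperm (b, k) (c, l) * (tperm (~~ b, k) (~~ c, l) * tperm (b, k) (c, l)) =
  tperm (~~ b, k) (~~ c, l) ^ tperm (b, k) (c, l) by rewrite /conjg tpermV.
rewrite tpermJ !tpermD //; try by rewrite xpair_eqE; case: (b) (c) => [] [].
by move: nyx; rewrite !xpair_eqE (eq_sym l); case: b c {nxy} => [] [].
Qed.

Lemma srank_sopp x : srank (sopp x) = n.*2.-1 - srank x.
Proof. by case: x => [[] [k kn]]; rewrite /srank /=; lia. Qed.

Lemma srank_lt x : srank x < n.*2.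
Proof. by case: x => [[] [k kn]]; rewrite /srank /=; lia. Qed.

(** The reflection t_0 exchanges 1 with -2 and 2 with -1, so exactly the four middle ranks move,
    each by two. *)
Lemma srank_tD0 k x : k = 0 :> nat -> srank (tD k x) =
  if (srank x == n) || (srank x == n.+1) then (srank x).-2
  else if (srank x == n.-1) || (srank x == n.-2) then (srank x).+2 else srank x.
Proof.
move=> k0; have k1 := val_ordS0 k0 n1; rewrite tD0E //; move: (ordS k) k1 => j j1.
have eqv (i l : 'I_n) : (i == l) = (i == l :> nat) by [].
case: x => b i; rewrite /= !eqv k0 j1 /srank; have := ltn_ord i.
by case: eqP => [->|ni]; [|case: eqP => [->|ni']]; case: b => /=;
  rewrite ?k0 ?j1; repeat case: ifP; lia.
Qed.

Lemma srank_tDS k x : k != 0 :> nat -> srank (tD k x) =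
  if (srank x == n + k) || (srank x == n - k) then (srank x).-1
  else if (srank x == n + k.-1) || (srank x == n - k.+1) then (srank x).+1
  else srank x.
Proof.
move=> k0; have k1 := val_ord_pred k0; rewrite /tD /toD (negPf k0) sBE (negPf k0).
move: (ord_pred k) k1 => j j1.
have eqv (i l : 'I_n) : (i == l) = (i == l :> nat) by [].
case: x => b i; rewrite /= !eqv j1 /srank; have := ltn_ord i; have := ltn_ord k.
by case: eqP => [->|ni]; [|case: eqP => [->|ni']]; case: b => /=;
  rewrite ?j1; repeat case: ifP; lia.
Qed.

(* [X] and [Y] are the ranks of [x] and [y]: the order of two elements that are
   not opposite is reversed by [t_0] only if they are -1, 2 or -2, 1. *)
Lemma rank_flip0 X Y : Y != n.*2.-1 - X -> X < Y -> Y < n.*2 -> X < n.*2 ->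
  (if (Y == n) || (Y == n.+1) then Y.-2
   else if (Y == n.-1) || (Y == n.-2) then Y.+2 else Y) <
  (if (X == n) || (X == n.+1) then X.-2
   else if (X == n.-1) || (X == n.-2) then X.+2 else X) ->
  (X = n.-1 /\ Y = n.+1) \/ (X = n.*2.-1 - n.+1 /\ Y = n.*2.-1 - n.-1).
Proof.
move=> nXY lXY y_lt x_lt.
have e1 : n.*2.-1 - n.+1 = n.-2 by lia.
have e2 : n.*2.-1 - n.-1 = n by lia.
(* The additive form avoids truncated subtraction in the case analysis. *)
rewrite e1 e2; have nXY' : X + Y <> n.*2.-1 by lia.
clear nXY e1 e2.
do 4?[case: eqP => ? /=]; do 4?[case: eqP => ? /=]; lia.
Qed.

Lemma rank_flipS X Y k : k != 0 :> nat -> X < Y -> Y < n.*2 -> X < n.*2 ->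
  (if (Y == n + k) || (Y == n - k) then Y.-1
   else if (Y == n + k.-1) || (Y == n - k.+1) then Y.+1 else Y) <
  (if (X == n + k) || (X == n - k) then X.-1
   else if (X == n + k.-1) || (X == n - k.+1) then X.+1 else X) ->
  (X = n + k.-1 /\ Y = n + k) \/
  (X = n.*2.-1 - (n + k) /\ Y = n.*2.-1 - (n + k.-1)).
Proof.
move=> k0 lXY y_lt x_lt; have k_lt := ltn_ord k.
have e1 : n.*2.-1 - (n + k) = n - k.+1 by lia.
have e2 : n.*2.-1 - (n + k.-1) = n - k by lia.
rewrite e1 e2; clear e1 e2; move: (nat_of_ord k) k0 k_lt => {}k k0 k_lt.
do 4?[case: eqP => ? /=]; do 4?[case: eqP => ? /=]; lia.
Qed.

(* The positive roots of type D are the [e_x - e_y] with [x < y] and [y != -x],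
   where [(x, y)] and [(-y, -x)] encode the same root: [t_k] makes only its own
   root negative. *)
Lemma tD_flip k x y : y != sopp x -> srank x < srank y ->
  srank (tD k y) < srank (tD k x) -> tD k = stperm x y.
Proof.
move=> nxy lt_xy; have nxy' : srank y != n.*2.-1 - srank x.
  by rewrite -srank_sopp (inj_eq srank_inj).
have nx : x != y by apply: contraTneq lt_xy => ->; rewrite ltnn.
have pairE u v :
    (srank x = srank u /\ srank y = srank v) \/
    (srank x = n.*2.-1 - srank v /\ srank y = n.*2.-1 - srank u) ->
    stperm u v = stperm x y.
  move=> [[/srank_inj-> /srank_inj->] //|].
  rewrite -!srank_sopp => -[/srank_inj xv /srank_inj yu].
  by rewrite -(stpermC nxy nx) xv yu /sopp /= !negbK; case: (u) (v) => ? ? [].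
have := srank_lt x; have := srank_lt y; have [k0|k0] := eqVneq (k : nat) 0.
  rewrite !srank_tD0 // tD0_stperm // => y_lt x_lt lt_t.
  have ru : srank (true, k) = n.-1 by rewrite /srank /= k0 subn1.
  have rv : srank (false, ordS k) = n.+1 by rewrite /srank (val_ordS0 k0 n1) addn1.
  apply: pairE; rewrite ru rv; exact: rank_flip0 lt_t.
rewrite !srank_tDS // tDS_stperm // => y_lt x_lt lt_t.
have ru : srank (false, ord_pred k) = n + k.-1 by rewrite /srank val_ord_pred.
have rv : srank (false, k) = n + k by [].
apply: pairE; rewrite ru rv; exact: rank_flipS lt_t.
Qed.

Lemma tD_WB i : tD i \in WB n.
Proof. by rewrite /tD /toD; case: ifP => _; rewrite ?groupM ?sB_WB. Qed.

Lemma prod_tD_WB (r : seq 'I_n) : \prod_(i <- r) tD i \in WB n.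
Proof. by apply: group_prod => i _; apply: tD_WB. Qed.

(* Along [r], the positive root of [t_i] becomes negative at some letter [k];
   there [t_k] is conjugate to [t_i] by the preceding prefix. *)
Lemma tD_descent_exchangeable i x y (r : seq 'I_n) :
  y != sopp x -> srank x < srank y -> tD i = stperm x y ->
  srank ((\prod_(j <- r) tD j) y) < srank ((\prod_(j <- r) tD j) x) ->
  exchangeable (@tD n) i r.
Proof.
move=> nxy lt_xy tE; elim/last_ind: r => [|r k IHr].
  by rewrite big_nil !perm1 ltnNge ltnW.
rewrite -cats1 big_cat big_seq1 /= !permM; set u := \prod_(j <- r) _ in IHr *.
have uWB : u \in WB n by apply: prod_tD_WB.
have uopp z : u (sopp z) = sopp (u z).
  by move: uWB; rewrite inE => /forallP/(_ z)/eqP.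
have [u_lt _|u_ge] := boolP (srank (u y) < srank (u x)).
  have [r1 [l [r2 [-> e]]]] := IHr u_lt; exists r1, l, (r2 ++ [:: k]).
  by rewrite -catA; split=> //; rewrite !catA big_cat mulgA e [RHS]big_cat.
have lt_u : srank (u x) < srank (u y).
  rewrite ltn_neqAle leqNgt u_ge andbT (inj_eq srank_inj) (inj_eq perm_inj).
  by apply: contraTneq lt_xy => ->; rewrite ltnn.
have nu : u y != sopp (u x) by rewrite -uopp (inj_eq perm_inj).
move/(tD_flip nu lt_u) => tk; exists r, k, [::]; split=> //.
rewrite cats0 big_cat big_seq1 /=.
have -> : tD k = tD i ^ u by rewrite tE stpermJ.
by rewrite -/u -conjgC mulgA tD_invol mul1g.
Qed.

(** As t_i exchanges [x] and [y], exactly one of [w] and [tD i * w] reverses their order. *)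
Lemma tD_descent i (w : {perm signed n}) :
  (forall r, \prod_(j <- r) tD j = w -> exchangeable (@tD n) i r) \/
  (forall r, \prod_(j <- r) tD j = tD i * w -> exchangeable (@tD n) i r).
Proof.
have [x [y [lt_xy nxy tE [tx ty]]]] := tD_simple i.
have [w_lt|w_ge] := boolP (srank (w y) < srank (w x)); [left|right] => r rE;
  apply: (tD_descent_exchangeable nxy lt_xy tE); rewrite rE // !permM tx ty.
rewrite ltn_neqAle leqNgt w_ge andbT (inj_eq srank_inj) (inj_eq perm_inj).
by apply: contraTneq lt_xy => ->; rewrite ltnn.
Qed.

(** * Parity, and words for the elements of W_D *)

Lemma odd_sB i : odd_perm (sB i) = (i == 0 :> nat).
Proof.
rewrite /sB; case: ifP => [_|/negbT i0]; first by rewrite odd_tperm xpair_eqE.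
by rewrite odd_permM !odd_tperm !xpair_eqE !eqxx eq_sym neq_ord_pred.
Qed.

(** Among the s_i only s_0 is odd, and t_0 contains it twice. *)
Lemma odd_WD (w : {perm signed n}) : w \in WD n -> odd_perm w = false.
Proof.
suff /fintype.subsetP/(_ w) : WD n \subset 'Alt_(signed n).
  by move=> h /h; rewrite Alt_even => /negPf.
rewrite gen_subG; apply/fintype.subsetP => _ /imsetP[i _ ->]; rewrite Alt_even.
rewrite /tD /toD; case: eqP => [i0|/eqP/negPf i0]; last by rewrite odd_sB i0.
by rewrite !odd_permM !odd_sB (val_ordS0 i0 n1) i0.
Qed.

Lemma prod_tD_WD (r : seq 'I_n) : \prod_(i <- r) tD i \in WD n.
Proof. by apply: group_prod => i _; apply/mem_gen/imset_f. Qed.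

Lemma WD_prod (w : {perm signed n}) : w \in WD n ->
  exists r : seq 'I_n, w = \prod_(i <- r) sB i.
Proof.
case/gen_prodgP => m [c cD ->]; elim: m c cD => [|m IHm] c cD.
  by exists [::]; rewrite big_ord0 big_nil.
have [|r re] := IHm (c \o widen_ord (leqnSn m)); first by move=> i; apply: cD.
rewrite big_ord_recr /=; have /imsetP[i _ ->] := cD ord_max.
exists (r ++ if i == 0 :> nat then [:: i; ordS i; i] else [:: i]).
rewrite big_cat -re /tD /toD; congr (_ * _).
by case: ifP => _; [rewrite 2!big_cons big_seq1 /= mulgA | rewrite big_seq1].
Qed.

End TypeD.

(** * Conversion of B-words into D-words *)

Section TypeBtoD.
Variable n : nat.
Hypothesis n1 : 1 < n.
Implicit Types (i j z : 'I_n) (r u : seq 'I_n).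

(* All letters [s_0] are moved to the left. Since [s_1 s_0 = s_0 t_0], the
   letter 1 becomes 0 when it is crossed an odd number of times. *)
Fixpoint BtoD r : bool * seq 'I_n :=
  if r is i :: r' then
    let: (e, u) := BtoD r' in
    if i == 0 :> nat then (~~ e, u)
    else (e, (if e && (i == 1%N :> nat) then ord_pred i else i) :: u)
  else (false, [::]).

(** The group is arbitrary so that the same conversion applies to the signed permutations [sB] and
    to the generators [s'] of the quotient. *)
Lemma BtoD_prod (G : groupType) (s : 'I_n -> G) z r : z = 0 :> nat ->
  s z * s z = 1 -> (forall j, 1 < j -> s z * s j = s j * s z) ->
  \prod_(i <- r) s i = s z ^+ (BtoD r).1 * \prod_(i <- (BtoD r).2) toD s i.
Proof.
move=> z0 szz comm; elim: r => [|i r IHr]; first by rewrite !big_nil mulg1.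
rewrite big_cons /= {}IHr; case: (BtoD r) => e u /=.
have [i0|i0] := eqVneq (i : nat) 0.
  have -> : i = z by apply: val_inj; rewrite /= i0.
  by case: e; rewrite /= ?expg0 ?expg1 mulgA ?szz ?mul1g ?mulg1.
rewrite /= big_cons; case: e => /=; last by rewrite !expg0 !mul1g /toD (negPf i0).
rewrite !expg1; case: eqP => [i1|/eqP i1].
  have pz : ord_pred i = z by apply: val_inj; rewrite [LHS](val_ord_pred i0) i1 [RHS]z0.
  by rewrite pz /toD z0 /= -pz ord_predK pz !mulgA szz mul1g.
by rewrite /toD (negPf i0) !mulgA comm //; case: (i : nat) i0 i1 => [|[]].
Qed.

(** Each letter of the D-word comes from one nonzero letter of [r]. Deleting that letter leaves the
    number of s_0 to the right of any other letter unchanged, so the rest is converted as before. *)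
Lemma BtoD_del r e u1 i u2 : BtoD r = (e, u1 ++ i :: u2) ->
  exists2 r', size r' < size r & BtoD r' = (e, u1 ++ u2).
Proof.
elim: r e u1 => [|j r IHr] e u1 /=; first by case: u1.
case er: (BtoD r) => [e' u]; case: ifP => j0 [<-].
  move=> eu; have [|r' r'_lt r'E] := IHr e' u1; first by rewrite er eu.
  by exists (j :: r') => //=; rewrite r'E j0.
case: u1 => [|k u1] /= []; first by move=> _ <-; exists r.
move=> <- uE.
have [|r' r'_lt r'E] := IHr e' u1; first by rewrite er uE.
by exists (j :: r') => //=; rewrite r'E j0.
Qed.

Lemma sB_comm0_gt1 z : z = 0 :> nat ->
  forall j, 1 < j -> sB z * sB j = sB j * sB z.
Proof. by move=> z0 j; apply: sB_comm0. Qed.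

(* If the D-word could be shortened, then by the deletion property it would
   lose two letters, and so would the B-word. *)
Lemma BtoD_reduced r : reduced (@sB n) r -> reduced (@tD n) (BtoD r).2.
Proof.
move=> red; apply: contrapT => /(deletion (@tD_invol n) (tD_descent n1)).
move=> [u1 [i [u2 [j [u3 [eu e]]]]]].
case er: (BtoD r) eu e => [b u] /= eu e.
rewrite eu in er; have [r1 r1_lt r1E] := BtoD_del er.
rewrite catA in r1E; have [r2 r2_lt r2E] := BtoD_del r1E.
have z0 : Ordinal (ltnW n1) = 0 :> nat by [].
have := red r2; rewrite !(BtoD_prod _ z0 (sB_invol _) (sB_comm0_gt1 z0)).
by rewrite er r2E /= -eu e -catA => /(_ erefl); rewrite leqNgt (ltn_trans r2_lt).
Qed.

(** * Canonical lifts and their images in the quotient *)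

Lemma s'_comm0 z : z = 0 :> nat ->
  forall j, 1 < j -> s' z * s' j = s' j * s' z.
Proof.
move=> z0 j j1; have nzj : z != j by apply/eqP => e; rewrite -e z0 in j1.
by have := s'_braided nzj; rewrite order_sB0 //= !mulg1.
Qed.

Lemma odd_prod_sB r : odd_perm (\prod_(i <- r) sB i) = (BtoD r).1.
Proof.
have z0 : Ordinal (ltnW n1) = 0 :> nat by [].
rewrite (BtoD_prod _ z0 (sB_invol _) (sB_comm0_gt1 z0)) odd_permM.
rewrite (odd_WD n1 (prod_tD_WD _)) addbF.
by case: (BtoD r).1; rewrite ?expg0 ?expg1 ?odd_perm1 // odd_sB.
Qed.

Lemma pi1_prod r : pi1 n (\prod_(i <- r) artin_gen (@sB n) i) = \prod_(i <- r) s' i.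
Proof. by rewrite gmulf_prod. Qed.

Lemma iotaAD_prod r :
  iotaAD n (\prod_(i <- r) artin_gen (@tD n) i) = \prod_(i <- r) t' i.
Proof. by rewrite gmulf_prod; apply: eq_bigr => i _; apply: iotaAD_gen. Qed.

Lemma piB_prod r : piB n (\prod_(i <- r) artin_gen (@sB n) i) = \prod_(i <- r) sB i.
Proof. by rewrite gmulf_prod; apply: eq_bigr => i _; apply: piB_gen. Qed.

Lemma s'_prod z r : z = 0 :> nat -> \prod_(i <- r) s' i =
  s' z ^+ (BtoD r).1 * iotaAD n (\prod_(i <- (BtoD r).2) artin_gen (@tD n) i).
Proof.
by move=> z0; rewrite iotaAD_prod; apply: BtoD_prod (s'_invol z0) (s'_comm0 z0).
Qed.

(** A reduced B-word for [w] is converted without a leftover s_0, as [w] is even. The resulting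
    reduced D-word may differ from the one that defines [b], and Matsumoto's theorem compares the
    two. *)
Lemma canonical_lift_D (w : {perm signed n}) b : w \in WD n ->
  canonical_lift (@tD n) w b -> exists2 c, canonical_lift (@sB n) w c &
    piB n c = w /\ pi1 n c = iotaAD n b.
Proof.
move=> wD [u [uw ured] ->].
have [r0 rw0] := WD_prod wD; have [r red rw] := reduced_exists (@sB n) r0.
rewrite -{}rw0 in rw.
exists (\prod_(i <- r) artin_gen (@sB n) i).
  by exists r => //; split=> // r' r'w; apply: red; rewrite r'w.
rewrite piB_prod; split=> //.
have z0 : Ordinal (ltnW n1) = 0 :> nat by [].
have e0 : (BtoD r).1 = false by rewrite -odd_prod_sB rw (odd_WD n1).
rewrite pi1_prod (s'_prod _ z0) e0 expg0 mul1g !iotaAD_prod.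
apply: (matsumoto (@tD_invol n) (tD_descent n1) (@t'_braided n)).
- exact: BtoD_reduced.
- by move=> u' u'e; apply: ured; rewrite u'e.
- rewrite uw -rw (BtoD_prod r z0 (sB_invol _) (sB_comm0_gt1 z0)) e0.
  by rewrite expg0 mul1g.
Qed.

(** The witness [v] is s_0^e [w], with e the parity of [w], and [b] is its lift along the converted
    word. *)
Lemma canonical_lift_B (w : {perm signed n}) c z : z = 0 :> nat ->
  canonical_lift (@sB n) w c -> piB n c = w /\
  exists v b, [/\ v \in WD n, canonical_lift (@tD n) v b &
    pi1 n c = s' z ^+ odd_perm w * iotaAD n b].
Proof.
move=> z0 [r [rw red] ->]; rewrite piB_prod; split=> //.
exists (\prod_(i <- (BtoD r).2) tD i).
exists (\prod_(i <- (BtoD r).2) artin_gen (@tD n) i); split.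
- exact: prod_tD_WD.
- exists (BtoD r).2 => //; split=> // u ue.
  by apply: BtoD_reduced => // r' r'e; apply: red; rewrite r'e.
- by rewrite pi1_prod (s'_prod _ z0) -rw odd_prod_sB.
Qed.

End TypeBtoD.

Unset Implicit Arguments.
Set Strict Implicit.

Theorem theorem3p3 (n : nat) (hn : (3 <= n)%N) :
  iotaAD n @` MikD n = pi1 n @` [set b | MikB n b /\ piB n b \in WD n].
Proof.
have n1 : 1 < n by apply: ltnW.
apply/seteqP; split=> [_ [_ [x [y [b [c [xD yD bx cy ->]]]]] <-]|].
  have [b' bx' [b'x b'b]] := canonical_lift_D n1 xD bx.
  have [c' cy' [c'y c'c]] := canonical_lift_D n1 yD cy.
  exists (b'^-1 * c'); last by rewrite !gmulfM !gmulfV b'b c'c.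
  split; last by rewrite gmulfM gmulfV b'x c'y groupM ?groupV.
  (* Membership of [x] and [y] in [WB n] is read off from their lifts. *)
  by exists x, y, b', c'; split=> //; rewrite -?b'x -?c'y piB_WB.
move=> _ [_ [[x [y [b [c [_ _ bx cy ->]]]]] xyD] <-].
have z0 : Ordinal (ltnW n1) = 0 :> nat by [].
have [bE [v [b' [vD bv bb']]]] := canonical_lift_B n1 z0 bx.
have [cE [w [c' [wD cw cc']]]] := canonical_lift_B n1 z0 cy.
exists (b'^-1 * c'); first by exists v, w, b', c'.
have exy : odd_perm x = odd_perm y.
  move: xyD; rewrite gmulfM gmulfV bE cE => /(odd_WD n1).
  by rewrite odd_permM odd_permV; do 2!case: odd_perm.
by rewrite !gmulfM !gmulfV bb' cc' exy invgM -!mulgA mulKg.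
Qed.
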